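(* Under the setting and all assumptions listed in the context, fix $\delta\in[0,1)$ and let $\{(\overline{\mathfrak a}_h,\overline u_h)\}_{h\in(0,h_0)}$ be a family such that, for each $h$, the pair $(\overline{\mathfrak a}_h,\overline u_h)$ minimizes $J$ over $\mathcal Z_h^\delta$. Then there is $(\overline{\mathfrak a},\overline u)\in\mathcal Z^\delta$ such that, as $h\downarrow0$ and up to sub-sequences, the following hold: (1) $\overline{\mathfrak a}_h\to\overline{\mathfrak a}$ in $(\mathcal H,d)$; (2) the pair $(\overline{\mathfrak a},\overline u)$ minimizes $J$ over $\mathcal Z^\delta$; (3) $J(\overline{\mathfrak a}_h,\overline u_h)\to J(\overline{\mathfrak a},\overline u)$; (4) $\overline u_h\to\overline u$ in $X_\delta$; (5) $\phi(\overline{\mathfrak a}_h)\to\phi(\overline{\mathfrak a})$.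
   Context: Setting. $(\mathcal H,d)$ is a nonempty compact metric space (the design space). $X_0$ and $X_1$ are real Hilbert spaces with $X_0$ compactly embedded and dense in $X_1$; $\langle\cdot,\cdot\rangle$ is the inner product of $X_1$. $\{X_\delta\}_{\delta\in[0,1]}$ is a family of Hilbert spaces (whose end points, at $\delta=0$ and $\delta=1$, are the Hilbert spaces $X_0$ and $X_1$, with $X_0$ compactly embedded and dense in $X_1$) such that $X_{\delta_1}\hookrightarrow X_{\delta_2}$ continuously (viewed as an inclusion) whenever $\delta_1<\delta_2$ in $[0,1]$, with embedding constant independent of $\delta_1,\delta_2$. $f\in X_1$ is fixed. For each $\delta\in[0,1)$, $\mathfrak B_\delta$ maps each $\mathfrak a\in\mathcal H$ to a bounded symmetric bilinear form $\mathfrak B_\delta[\mathfrak a]$ on $X_\delta$. The energy is $E_\delta[\mathfrak a](w)=\frac12\mathfrak B_\delta[\mathfrak a](w,w)-\langle f,w\rangle$, $w\in X_\delta$. The admissible set is $\mathcal Z^\delta=\{(\mathfrak a,u)\in\mathcal H\times X_\delta: u\in\operatorname{argmin}_{w\in X_\delta}E_\delta[\mathfrak a](w)\}$; equivalently $\mathfrak B_\delta[\mathfrak a](u,v)=\langle f,v\rangle$ for all $v\in X_\delta$. The function $\phi:\mathcal H\to\mathbb R$ is non-negative, convex and lower semicontinuous (convexity refers to a convex structure of $\mathcal H$ when it carries one; none is otherwise assumed). The objective is $J(\mathfrak b,w)=\langle f,w\rangle+\phi(\mathfrak b)$ for $\mathfrak b\in\mathcal H$, $w\in X_1$. Structural assumptions.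 (S1) There is $M>0$ with $\|v\|_{X_1}\le M\|v\|_{X_\delta}$ for all $\delta\in[0,1)$, $v\in X_\delta$. (S2) If $v_\delta\in X_\delta$ for $\delta\in(0,1)$ and $\|v_\delta\|_{X_\delta}$ stays bounded as $\delta\downarrow0$, then $\{v_\delta\}$ is relatively compact in $X_1$ and any limit point (as $\delta\downarrow0$) belongs to $X_0$. (B1) For every $\delta\in[0,1)$: if $\mathfrak a_j\to\mathfrak a$ in $(\mathcal H,d)$, then $\mathfrak B_\delta[\mathfrak a_j](v,v)\to\mathfrak B_\delta[\mathfrak a](v,v)$ for every $v\in X_\delta$. (B2) There is $A>0$ with $|\mathfrak B_\delta[\mathfrak a](v,v)|\le A\|v\|_{X_\delta}^2$ for all $\delta\in[0,1)$, $\mathfrak a\in\mathcal H$, $v\in X_\delta$. (B3) There is $\alpha>0$ with $\alpha\|v\|_{X_\delta}^2\le\mathfrak B_\delta[\mathfrak a](v,v)$ for all $\delta\in[0,1)$, $\mathfrak a\in\mathcal H$, $v\in X_\delta$. (B4) If $\mathfrak a_\delta\to\mathfrak a$ in $(\mathcal H,d)$ as $\delta\downarrow0$, then $\mathfrak B_\delta[\mathfrak a_\delta](v,w)-\mathfrak B_\delta[\mathfrak a](v,w)\to0$ as $\delta\downarrow0$ for all $v,w\in X_0$. (B5) $\lim_{\delta\downarrow0}\mathfrak B_\delta[\mathfrak a](v,w)=\mathfrak B_0[\mathfrak a](v,w)$ for all $\mathfrak a\in\mathcal H$, $v,w\in X_0$. (B6) If $\mathfrak a\in\mathcal H$, $v_\delta\in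 X_\delta$, $v\in X_0$ and $v_\delta\to v$ in $X_1$ as $\delta\downarrow0$, then $\mathfrak B_0[\mathfrak a](v,v)\le\liminf_{\delta\downarrow0}\mathfrak B_\delta[\mathfrak a](v_\delta,v_\delta)$. Discretization. $h_0>0$. For every $\delta\in[0,1)$ and $h\in(0,h_0)$, $X_{\delta,h}\subset X_\delta$ is a finite dimensional subspace (with the norm of $X_\delta$), and $\mathcal H_h$ is a closed subset of $\mathcal H$. The discrete admissible set is $\mathcal Z_h^\delta=\{(\mathfrak a_h,u_h)\in\mathcal H_h\times X_{\delta,h}:u_h\in\operatorname{argmin}_{w_h\in X_{\delta,h}}E_\delta[\mathfrak a_h](w_h)\}$. Assumptions on the discretization. (D1) For fixed $h$, $X_{\delta_1,h}\hookrightarrow X_{\delta_2,h}$ (inclusion) for $\delta_1<\delta_2$ in $[0,1)$, with embedding constant independent of $h,\delta_1,\delta_2$. (D2) For every $\delta\in[0,1)$ and $w\in X_\delta$ there are $w_h\in X_{\delta,h}$ with $\|w-w_h\|_{X_\delta}\to0$ as $h\downarrow0$. (D3) For each $h$ there is a mapping $\Pi_h:\mathcal H\to\mathcal H_h$ such that $\phi(\Pi_h\mathfrak a)\to\phi(\mathfrak a)$ as $h\downarrow0$ for every $\mathfrak a\in\mathcal H$. (D4) For $\delta\in[0,1)$, $\mathfrak b\in\mathcal H$, define $\hat{\mathcal G}_{\delta,h}[\mathfrak b]:X_\delta\to X_{\delta,h}$ by $\mathfrak B_\delta[\Pi_h\mathfrak b](\hat{\mathcal G}_{\delta,h}[\mathfrak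 b]v,w_h)=\mathfrak B_\delta[\mathfrak b](v,w_h)$ for all $w_h\in X_{\delta,h}$. Then $\|v-\hat{\mathcal G}_{\delta,h}[\mathfrak b]v\|_{X_\delta}\to0$ as $h\downarrow0$ for all $(\mathfrak b,v)\in\mathcal Z^\delta$. ''Up to sub-sequences'' means: there is one sequence $h_j\downarrow0$ along which all the stated convergences hold. *)

(* Defs.v *)
From mathcomp Require Import all_boot all_order all_algebra.
From mathcomp Require Import sesquilinear interval_inference.
From mathcomp Require Import all_classical all_reals all_analysis.
Set Implicit Arguments.
Unset Strict Implicit.
Unset Printing Implicit Defensive.
Import Order.TTheory GRing.Theory Num.Theory.
Import numFieldNormedType.Exports.
Local Open Scope classical_set_scope.
Local Open Scope ring_scope.

Definition argmin_over {R : realType} {T : Type} (A : set T) (F : T -> R) :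
    set T :=
  [set x | A x /\ forall y, A y -> F x <= F y].

(* A complete normed module is a Hilbert space when its norm comes from an
   inner product. *)
Definition induces_norm {R : realType} (V : normedModType R)
    (ip : {dot V for idfun}) : Prop :=
  forall v, ip v v = `|v| ^+ 2.

Definition bounded_form {R : realType} (V : normedModType R)
    (b : {symmetric V}) : Prop :=
  exists C : R, forall v w, `|b v w| <= C * `|v| * `|w|.

Definition finite_dim_subspace {R : realType} (V : lmodType R) (A : set V) :
    Prop :=
  exists (n : nat) (e : 'I_n -> V),
    A = [set \sum_(i < n) c i *: e i | c in [set: 'I_n -> R]].

(* The optional convex structure: [None] when the space carries none, in which
   case convexity is no condition. *)
Definition convex_for {R : realType} (T : Type)
    (cvx : option (isConvexSpace.axioms_ R T)) (phi : T -> R) : Prop :=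
  if cvx is Some m then
    forall (t : {i01 R}) (a b : T),
      phi (isConvexSpace.conv m t a b)
        <= t%:num * phi a + (1 - t%:num) * phi b
  else True.

Section scale.
Context {R : realType} (X : R -> completeNormedModType R).

(* The inclusions [X d1 `<=` X d2] are represented by injections; [incl] is
   only meaningful for [0 <= d1 <= d2 <= 1], just as [X] is for [0 <= d <= 1].
   An element of [X d] "in [X 1]" is thus its image by [incl d 1]. *)
Context (incl : forall d1 d2 : R, {linear X d1 -> X d2}).

Definition coherent_inclusions : Prop :=
  [/\ forall d v, 0 <= d <= 1 -> incl d d v = v,
      forall d1 d2 d3 v, 0 <= d1 -> d1 <= d2 -> d2 <= d3 -> d3 <= 1 ->
        incl d2 d3 (incl d1 d2 v) = incl d1 d3 v
    & forall d1 d2, 0 <= d1 -> d1 <= d2 -> d2 <= 1 ->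
        injective (incl d1 d2)].

Definition uniformly_continuous_inclusions : Prop :=
  exists2 C : R, 0 < C & forall d1 d2 (v : X d1),
    0 <= d1 -> d1 < d2 -> d2 <= 1 -> `|incl d1 d2 v| <= C * `|v|.

Definition compactly_embedded_dense : Prop :=
  (forall A : set (X 0), bounded_set A -> precompact (incl 0 1 @` A)) /\
  dense (range (incl 0 1)).

Definition assumption_S1 : Prop :=
  exists2 M : R, 0 < M & forall d (v : X d),
    0 <= d < 1 -> `|incl d 1 v| <= M * `|v|.

(* Relative compactness of the family is meant as [d] tends to 0: every
   sequence of parameters tending to 0 has a subsequence along which [v]
   converges. Nothing is asserted for parameters away from 0, where [v] need
   not even be bounded. *)
Definition assumption_S2 : Prop :=
  forall v : (forall d, X d),
    (exists K : R, \forall d \near 0^'+, `|v d| <= K) ->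
    (forall s : nat -> R, (forall n, 0 < s n < 1) ->
       s n @[n --> \oo] --> (0 : R) ->
       exists (k : nat -> nat) (l : X 1),
         increasing_seq k /\
         incl (s (k n)) 1 (v (s (k n))) @[n --> \oo] --> l) /\
    cluster (incl d 1 (v d) @[d --> 0^'+]) `<=` range (incl 0 1).

Context {H : metricType R}.
Context (B : forall d : R, H -> {symmetric X d}).

Definition assumption_B1 : Prop :=
  forall (d : R) (s : nat -> H) (a : H), 0 <= d < 1 ->
    s n @[n --> \oo] --> a ->
    forall v, B d (s n) v v @[n --> \oo] --> B d a v v.

Definition assumption_B2 : Prop :=
  exists2 A : R, 0 < A & forall d a (v : X d),
    0 <= d < 1 -> `|B d a v v| <= A * `|v| ^+ 2.

Definition assumption_B3 : Prop :=
  exists2 alpha : R, 0 < alpha & forall d a (v : X d),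
    0 <= d < 1 -> alpha * `|v| ^+ 2 <= B d a v v.

Definition assumption_B4 : Prop :=
  forall (s : R -> H) (a : H), s d @[d --> 0^'+] --> a ->
    forall v w : X 0,
      B d (s d) (incl 0 d v) (incl 0 d w) - B d a (incl 0 d v) (incl 0 d w)
        @[d --> 0^'+] --> (0 : R).

Definition assumption_B5 : Prop :=
  forall (a : H) (v w : X 0),
    B d a (incl 0 d v) (incl 0 d w) @[d --> 0^'+] --> B 0 a v w.

Definition assumption_B6 : Prop :=
  forall (a : H) (vs : forall d, X d) (v : X 0),
    incl d 1 (vs d) @[d --> 0^'+] --> incl 0 1 v ->
    ((B 0 a v v)%:E
      <= limf_einf (fun d : R => (B d a (vs d) (vs d))%:E) 0^'+)%E.

Context (ip : forall d : R, {dot X d for idfun}) (f : X 1) (phi : H -> R).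

Definition energy (d : R) (a : H) (w : X d) : R :=
  2^-1 * B d a w w - ip 1 f (incl d 1 w).

Definition objective (b : H) (w : X 1) : R := ip 1 f w + phi b.

Definition admissible (d : R) : set (H * X d) :=
  [set p | argmin_over [set: X d] (energy p.1) p.2].

Context (h0 : R) (Xh : forall d : R, R -> set (X d)) (Hh : R -> set H).
Arguments Xh : clear implicits.

Definition discrete_admissible (d h : R) : set (H * X d) :=
  [set p | Hh h p.1 /\ argmin_over (Xh d h) (energy p.1) p.2].

Definition minimizes_objective (d : R) (Z : set (H * X d)) : set (H * X d) :=
  argmin_over Z (fun p => objective p.1 (incl d 1 p.2)).

Definition assumption_D1 : Prop :=
  exists2 C : R, 0 < C & forall h d1 d2 (v : X d1),
    0 < h < h0 -> 0 <= d1 -> d1 < d2 -> d2 < 1 -> Xh d1 h v ->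
    Xh d2 h (incl d1 d2 v) /\ `|incl d1 d2 v| <= C * `|v|.

Definition assumption_D2 : Prop :=
  forall (d : R) (w : X d), 0 <= d < 1 ->
    exists2 wh : R -> X d, forall h, 0 < h < h0 -> Xh d h (wh h)
      & `|w - wh h| @[h --> 0^'+] --> (0 : R).

Context (Pi : R -> H -> H).

Definition assumption_D3 : Prop :=
  (forall h a, 0 < h < h0 -> Hh h (Pi h a)) /\
  (forall a, phi (Pi h a) @[h --> 0^'+] --> phi a).

(* For a coercive form and a finite dimensional [Xh d h] the defining equation
   has exactly one solution (Lax-Milgram), and [xget] returns it. *)
Definition Ghat (d h : R) (b : H) (v : X d) : X d :=
  xget 0 [set g | Xh d h g /\
    forall wh, Xh d h wh -> B d (Pi h b) g wh = B d b v wh].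

Definition assumption_D4 : Prop :=
  forall (d : R) (b : H) (v : X d), 0 <= d < 1 -> admissible (b, v) ->
    `|v - Ghat h b v| @[h --> 0^'+] --> (0 : R).

End scale.

(* Main.v *)
(* The state equation makes the compliance <f, u> equal to
   max_w (2 <f, w> - B[a](w, w)). For fixed w this depends continuously on the
   design (B1), so the compliance is lower semicontinuous along a convergent
   sequence of discrete designs, although the states themselves need not depend
   continuously on the design. Conversely, for every continuous
   admissible pair (b, v) the pairs (Pi_h b, Ghat_h v) are discretely admissible
   and their objectives tend to that of (b, v), so the limit design is optimal
   and the objectives converge. As <f, u> and phi are both
   lower semicontinuous along the sequence and their sum converges, each
   converges; convergence of the compliances gives strong convergence of the
   states, since for interpolants w_h of u
   B[a_h](u_h - w_h, u_h - w_h) = <f, u_h> - (2 <f, w_h> - B[a_h](w_h, w_h))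
   tends to 0. *)
Require Import Defs.
From mathcomp Require Import all_boot all_order all_algebra.
From mathcomp Require Import sesquilinear interval_inference.
From mathcomp Require Import all_classical all_reals all_analysis.
From mathcomp Require Import ring lra.
Set Implicit Arguments.
Unset Strict Implicit.
Unset Printing Implicit Defensive.
Import Order.TTheory GRing.Theory Num.Theory.
Import numFieldNormedType.Exports.
Local Open Scope classical_set_scope.
Local Open Scope ring_scope.

(** * Symmetric bilinear forms: Cauchy-Schwarz, Euler equation, finite dimensional solvability *)

(** Discriminant bound. For [c > 0] evaluate at the minimizer [- p / c]; for [c = 0] the affine
    function takes the value -1 somewhere unless [p = 0]. *)
Lemma sqr_le_mul_of_quadratic_ge0 {R : realFieldType} (a p c : R) :
  0 <= c -> (forall t, 0 <= a + 2 * t * p + t ^+ 2 * c) -> p ^+ 2 <= a * c.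
Proof.
rewrite le_eqVlt => /predU1P[<-|c_gt0] q_ge0; last first.
  have := q_ge0 (- p / c).
  have -> : a + 2 * (- p / c) * p + (- p / c) ^+ 2 * c = (a * c - p ^+ 2) / c.
    by field; rewrite gt_eqF.
  by rewrite pmulr_lge0 ?invr_gt0// subr_ge0.
have [->|p_neq0] := eqVneq p 0; first by rewrite mulr0 expr0n.
have := q_ge0 (- (a + 1) / (2 * p)).
have -> : a + 2 * (- (a + 1) / (2 * p)) * p = - 1 by field.
by rewrite mulr0; lra.
Qed.

Lemma symmetric_formC {R : realType} (V : lmodType R) (b : {symmetric V}) u v :
  b u v = b v u.
Proof. by rewrite hermC expr0 mul1r. Qed.

Lemma form_linear {R : realType} (V : lmodType R) (b : {symmetric V}) u :
  scalar (b u).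
Proof. by move=> t v w; rewrite linearDr linearZr_LR. Qed.

Lemma form_linearl {R : realType} (V : lmodType R) (b : {symmetric V}) u :
  scalar (b^~ u).
Proof. by move=> t v w; rewrite /= !(symmetric_formC b _ u) form_linear. Qed.

Lemma form_DZ {R : realType} (V : lmodType R) (b : {symmetric V}) u v t :
  b (u + t *: v) (u + t *: v) = b u u + 2 * t * b u v + t ^+ 2 * b v v.
Proof.
rewrite addrC form_linearl !form_linear (symmetric_formC b v u).
by ring.
Qed.

Lemma form_B {R : realType} (V : lmodType R) (b : {symmetric V}) u v :
  b (u - v) (u - v) = b u u - 2 * b u v + b v v.
Proof. by rewrite -scaleN1r form_DZ; ring. Qed.

Lemma form_CauchySchwarz {R : realType} (V : lmodType R) (b : {symmetric V})
    u v :
  (forall w, 0 <= b w w) -> b u v ^+ 2 <= b u u * b v v.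
Proof.
by move=> b_ge0; apply: sqr_le_mul_of_quadratic_ge0 => // t; rewrite -form_DZ.
Qed.

(** Cauchy-Schwarz carries a bound on the quadratic form over to the bilinear form with the same
    constant. Applied to (B2), it gives a continuity constant independent of the design. *)
Lemma form_bound {R : realType} (V : normedModType R) (b : {symmetric V})
    (C : R) :
  0 <= C -> (forall v, 0 <= b v v) -> (forall v, b v v <= C * `|v| ^+ 2) ->
  forall u v, `|b u v| <= C * `|u| * `|v|.
Proof.
move=> C_ge0 b_ge0 b_le u v.
have Cuv : 0 <= C * `|u| * `|v| by rewrite !mulr_ge0.
rewrite -(@ler_pXn2r _ 2)// ?nnegrE// real_normK ?num_real//.
rewrite (le_trans (form_CauchySchwarz u v b_ge0))//.
rewrite (le_trans (ler_pM _ _ (b_le u) (b_le v)))// le_eqVlt; apply/orP; left.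
by apply/eqP; ring.
Qed.

(** Twice the energy increment from [u] to [u + t *: w] is [2 * t * (b u w - l w) + t ^+ 2 * b w w];
    the discriminant bound with [a = 0] kills the linear coefficient. *)
Lemma form_argmin_Euler {R : realType} (V : lmodType R) (b : {symmetric V})
    (l : V -> R) (W : set V) (u : V) :
  (forall v, 0 <= b v v) -> scalar l ->
  (forall v w t, W v -> W w -> W (v + t *: w)) ->
  argmin_over W (fun w => 2^-1 * b w w - l w) u ->
  forall w, W w -> b u w = l w.
Proof.
move=> b_ge0 l_lin W_lin [Wu u_min] w Ww.
have : (b u w - l w) ^+ 2 <= 0 * b w w.
  apply: sqr_le_mul_of_quadratic_ge0 => // t.
  have := u_min _ (W_lin _ _ t Wu Ww).
  by rewrite form_DZ [u + _]addrC l_lin; lra.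
rewrite mul0r => /(conj (sqr_ge0 (b u w - l w)))/andP/le_anti/esym/eqP.
by rewrite sqrf_eq0 subr_eq0 => /eqP.
Qed.

(** The energy of [w] exceeds that of [u] by half of [b (u - w) (u - w)]. *)
Lemma form_Euler_argmin {R : realType} (V : lmodType R) (b : {symmetric V})
    (l : V -> R) (W : set V) (u : V) :
  (forall v, 0 <= b v v) -> W u -> (forall w, W w -> b u w = l w) ->
  argmin_over W (fun w => 2^-1 * b w w - l w) u.
Proof.
move=> b_ge0 Wu u_eq; split=> // w Ww.
by have := b_ge0 (u - w); rewrite form_B !u_eq//; lra.
Qed.

Lemma finite_dim_subspace_lin {R : realType} (V : lmodType R) (W : set V) :
  finite_dim_subspace W -> forall v w t, W v -> W w -> W (v + t *: w).
Proof.
move=> [n [e ->]] _ _ t [c _ <-] [c' _ <-].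
exists (fun i => c i + t * c' i) => //.
rewrite scaler_sumr -big_split/=; apply: eq_bigr => i _.
by rewrite scalerDl scalerA.
Qed.

(* Induction on the dimension: the last generator is replaced by its
   [b]-orthogonal component with respect to the span of the others. *)
Lemma form_solve_span {R : realType} (V : lmodType R) (b : {symmetric V}) :
  (forall v, 0 <= b v v) -> (forall v, b v v = 0 -> v = 0) ->
  forall (W : set V) (l : V -> R), finite_dim_subspace W -> scalar l ->
  exists2 g, W g & forall w, W w -> b g w = l w.
Proof.
move=> b_ge0 b_def W l [n [e ->]].
elim: n e l => [|n IHn] e l l_lin.
  exists 0; first by exists (fun=> 0) => //; rewrite big_ord0.
  move=> _ [c _ <-]; rewrite big_ord0 linear0l.
  by have := l_lin (-1) 0 0; rewrite scaler0 addr0; lra.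
pose e' i := e (widen_ord (leqnSn n) i).
have [p [cp _ <-] p_eq] := IHn e' _ (form_linear b (e ord_max)).
have [g [cg _ <-] g_eq] := IHn e' l l_lin.
set p_ := \sum_(i < n) _ in p_eq; set g_ := \sum_(i < n) _ in g_eq.
pose r := e ord_max - p_.
have r_perp c : b r (\sum_(i < n) c i *: e' i) = 0.
  rewrite /r addrC -scaleN1r form_linearl p_eq; last by exists c.
  by rewrite mulN1r addNr.
(* Chosen so that [t *: r + g_] satisfies the equation tested with [r]. If [b r r = 0], then [r = 0]
   and that equation is trivial. *)
pose t := (l r - b g_ r) / b r r.
have b_t : b g_ r + t * b r r = l r.
  have [r0|r_neq0] := eqVneq (b r r) 0.
    rewrite (b_def _ r0) !linear0r addr0.
    by have := l_lin (-1) 0 0; rewrite scaler0 addr0; lra.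
  by rewrite divfK//; ring.
have sum_r (c : 'I_n.+1 -> R) : \sum_(i < n.+1) c i *: e i =
    (c ord_max) *: r +
    \sum_(i < n) (c (widen_ord (leqnSn n) i) + c ord_max * cp i) *: e' i.
  have -> : \sum_(i < n) (c (widen_ord (leqnSn n) i) + c ord_max * cp i) *: e' i
      = c ord_max *: p_ + \sum_(i < n) c (widen_ord (leqnSn n) i) *: e' i.
    rewrite addrC scaler_sumr -big_split/=; apply: eq_bigr => i _.
    by rewrite scalerDl scalerA.
  by rewrite big_ord_recr addrA -scalerDr subrK addrC.
exists (t *: r + g_).
  (* The term [t * cp j] compensates for the [p_] subtracted in [r]. *)
  exists (fun i => if unlift ord_max i is Some j then cg j - t * cp j else t) => //.
  rewrite sum_r unlift_none; congr (_ + _); apply: eq_bigr => i _.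
  have -> : widen_ord (leqnSn n) i = lift ord_max i.
    by apply: val_inj; rewrite /= /bump leqNgt ltn_ord.
  by rewrite liftK subrK.
move=> _ [c _ <-]; rewrite sum_r l_lin form_linear !form_linearl.
rewrite r_perp; set w := \sum_(i < n) _.
have -> : b g_ w = l w by apply: g_eq; eexists; last reflexivity.
by rewrite -b_t; ring.
Qed.

(** * Limits of norms, functionals and forms *)

Lemma cvg_of_dist0 {R : realType} (V : normedModType R) (T : Type)
    (F : set_system T) {FF : Filter F} (v : T -> V) (w : V) :
  `|w - v i| @[i --> F] --> (0 : R) -> v i @[i --> F] --> w.
Proof.
move=> /norm_cvg0 vw0; rewrite -[w]subr0.
have -> : v = (fun i => w - (w - v i)) by apply/funext => i; rewrite subKr.
by apply: cvgB => //; exact: cvg_cst.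
Qed.

Lemma cvg_dist0 {R : realType} (V : normedModType R) (T : Type)
    (F : set_system T) {FF : Filter F} (v : T -> V) (w : V) :
  v i @[i --> F] --> w -> `|v i - w| @[i --> F] --> (0 : R).
Proof.
move=> v_w; rewrite -(normr0 V) -(subrr w).
by apply: cvg_norm; apply: cvgB => //; exact: cvg_cst.
Qed.

Lemma scalar_cvg {R : realType} (V : normedModType R) (T : Type)
    (F : set_system T) {FF : Filter F} (l : V -> R) (K : R) (v : T -> V) (w : V) :
  scalar l -> (forall x, `|l x| <= K * `|x|) ->
  v i @[i --> F] --> w -> l (v i) @[i --> F] --> l w.
Proof.
move=> l_lin l_le v_w.
have n0 : K * `|v i - w| @[i --> F] --> (0 : R).
  rewrite -[X in _ --> X](mulr0 K); apply: cvgM; first exact: cvg_cst.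
  exact: cvg_dist0.
apply: (@squeeze_cvgr _ _ _ _ (fun i => l w - K * `|v i - w|)
   (fun i => l w + K * `|v i - w|)).
- apply: nearW => i.
  have -> : l (v i) = l (v i - w) + l w.
    by rewrite -[l (_ - _)]mul1r -l_lin scale1r subrK.
  have := l_le (v i - w).
  by rewrite ler_norml => /andP[? ?]; apply/andP; split; lra.
- by rewrite -[X in _ --> X]subr0; apply: cvgB => //; exact: cvg_cst.
- by rewrite -[X in _ --> X]addr0; apply: cvgD => //; exact: cvg_cst.
Qed.

(** The lower bound is required only eventually and up to each [e], which is the form in which lower
    semicontinuity of [phi] provides it. *)
Lemma squeeze_cvgr_eps {R : realType} (T : Type) (F : set_system T)
    {FF : Filter F} (lo g up : T -> R) (c : R) :
  (forall e, 0 < e -> \forall i \near F, lo i - e <= g i) ->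
  (forall i, g i <= up i) ->
  lo i @[i --> F] --> c -> up i @[i --> F] --> c -> g i @[i --> F] --> c.
Proof.
move=> lo_g g_up lo_c up_c; apply/cvgrPdist_le => e e_gt0.
have e2_gt0 : 0 < e / 2 by rewrite divr_gt0.
have {}lo_g := lo_g _ e2_gt0.
move/cvgrPdist_le/(_ _ e2_gt0) : lo_c => lo_c.
move/cvgrPdist_le/(_ _ e_gt0) : up_c => up_c.
apply: filterS3 lo_g lo_c up_c => i h1; rewrite !ler_norml => /andP[? ?] /andP[? ?].
by have := g_up i => ?; apply/andP; split; lra.
Qed.

(** The bound [C] is uniform in [i], so the argument can be frozen at [w]: in the expansion around
    [w] all terms containing [v i - w] vanish in the limit. *)
Lemma form_cvg {R : realType} (V : normedModType R) (T : Type)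
    (F : set_system T) {FF : Filter F} (b : T -> {symmetric V}) (C beta : R)
    (v : T -> V) (w : V) :
  (forall i x y, `|b i x y| <= C * `|x| * `|y|) ->
  v i @[i --> F] --> w -> b i w w @[i --> F] --> beta ->
  b i (v i) (v i) @[i --> F] --> beta.
Proof.
move=> b_le v_w b_w.
have vw0 : `|v i - w| @[i --> F] --> (0 : R) by exact: cvg_dist0.
pose g i := C * `|v i - w| * `|v i - w| + 2 * (C * `|v i - w| * `|w|).
have g0 : g i @[i --> F] --> (0 : R).
  have -> : (0 : R) = C * 0 * 0 + 2 * (C * 0 * `|w|) by ring.
  apply: cvgD; first by apply: cvgM => //; apply: cvgM => //; exact: cvg_cst.
  apply: cvgM; first exact: cvg_cst.
  by apply: cvgM; [apply: cvgM => //|]; exact: cvg_cst.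
apply: (@squeeze_cvgr _ _ _ _ (fun i => b i w w - g i) (fun i => b i w w + g i)).
- apply: nearW => i; have -> : v i = w + 1 *: (v i - w) by rewrite scale1r addrC subrK.
  rewrite form_DZ.
  have := b_le i (v i - w) (v i - w); have := b_le i w (v i - w).
  rewrite !ler_norml /g => /andP[h1 h2] /andP[h3 h4].
  have e : C * `|w| * `|v i - w| = C * `|v i - w| * `|w| by ring.
  by rewrite e in h1 h2; apply/andP; split; lra.
- by rewrite -[X in _ --> X]subr0; exact: cvgB.
- by rewrite -[X in _ --> X]addr0; exact: cvgD.
Qed.

(** * Existence of the state, and extraction of a convergent sequence of designs *)

(** Direct method: the parallelogram identity of [b] makes a minimizing sequence Cauchy, and the
    energy is continuous. *)
Lemma coercive_argmin {R : realType} (V : completeNormedModType R)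
    (b : {symmetric V}) (l : V -> R) (alpha C K : R) :
  0 < alpha -> (forall v, alpha * `|v| ^+ 2 <= b v v) ->
  (forall v w, `|b v w| <= C * `|v| * `|w|) ->
  scalar l -> (forall v, `|l v| <= K * `|v|) ->
  exists u, argmin_over setT (fun w => 2^-1 * b w w - l w) u.
Proof.
move=> alpha_gt0 b_ge b_le l_lin l_le.
pose E w := 2^-1 * b w w - l w.
have E_inf : has_inf (range E).
  split; first by exists (E 0), 0.
  (* The minimum of [alpha / 2 * r ^+ 2 - K * r], by completing the square. *)
  exists (- (K ^+ 2 / (2 * alpha))) => _ [v _ <-]; rewrite /E.
  have := b_ge v; have := l_le v; rewrite ler_norml => /andP[_ lv] bv.
  have := sqr_ge0 (K - alpha * `|v|) => sq.
  have : 0 <= (K - alpha * `|v|) ^+ 2 / (2 * alpha) by rewrite divr_ge0// mulr_ge0// ltW.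
  have -> : (K - alpha * `|v|) ^+ 2 / (2 * alpha) =
      K ^+ 2 / (2 * alpha) - K * `|v| + 2^-1 * (alpha * `|v| ^+ 2).
    by field; rewrite gt_eqF.
  by lra.
set m := inf (range E).
have mE v : m <= E v by apply: ge_inf; [case: E_inf|exists v].
have /choice[v v_min] n : exists v, E v < m + harmonic n.
  by have [_ [v _ <-] ?] := inf_adherent (@harmonic_gt0 R n) E_inf; exists v.
have l_mid x y : l (2^-1 *: (x + y)) = 2^-1 * (l x + l y).
  have l0 : l 0 = 0 by have := l_lin (-1) 0 0; rewrite scaler0 addr0; lra.
  have lD : l (x + y) = l x + l y by rewrite -[x]scale1r l_lin mul1r scale1r.
  by rewrite -[2^-1 *: _]addr0 l_lin l0 addr0 lD.
(* [b (x - y) (x - y)] is four times [E x + E y] minus twice the energy of the midpoint, which is at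
   least [m]. *)
have par x y : alpha * `|x - y| ^+ 2 <= 4 * (E x - m + (E y - m)).
  apply: (le_trans (b_ge _)); have := mE (2^-1 *: (x + y)).
  rewrite /E l_mid -[_ *: _]add0r form_DZ form_B.
  have -> : b (x + y) (x + y) = b x x + 2 * b x y + b y y.
    by rewrite -{1 2}[y]scale1r form_DZ; ring.
  by rewrite !linear0l; lra.
have : cvg (v @ \oo).
  apply/cauchy_cvgP/cauchy_exP => e e_gt0.
  have d_gt0 : 0 < alpha * e ^+ 2 / 8 by rewrite divr_gt0// mulr_gt0// exprn_gt0.
  have [N _ hN] : \forall n \near \oo, harmonic n < alpha * e ^+ 2 / 8 :> R.
    by apply: cvgr_lt d_gt0; exact: cvg_harmonic.
  exists (v N); exists N => // n /= Nn.
  rewrite -ball_normE /= -(@ltr_pXn2r _ 2)// ?nnegrE// ?(ltW e_gt0)//.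
  rewrite -(ltr_pM2l alpha_gt0) (le_lt_trans (par _ _))//.
  have aux (x y dx dy p : R) : x < m + dx -> y < m + dy -> dx < p / 8 ->
      dy < p / 8 -> 4 * (x - m + (y - m)) < p by lra.
  exact: aux (v_min N) (v_min n) (hN N (leqnn N)) (hN n Nn).
move=> /cvg_ex[u v_u]; exists u; split=> // w _.
apply: le_trans (mE w).
have l_cvg : l (v n) @[n --> \oo] --> l u by exact: scalar_cvg l_le v_u.
have E_cvg : E (v n) @[n --> \oo] --> E u.
  apply: cvgB => //; apply: cvgM; first exact: cvg_cst.
  by apply: (@form_cvg _ _ _ _ _ (fun=> b) C) v_u _ => //; exact: cvg_cst.
have m_cvg : m + harmonic n @[n --> \oo] --> m.
  by rewrite -[X in _ --> X]addr0; apply: cvgD; [exact: cvg_cst|exact: cvg_harmonic].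
by apply: (ler_cvg_to E_cvg m_cvg); apply: nearW => n; exact: ltW.
Qed.

(** A cluster point of [g] at [0^'+] is approached by values of [g] at arbitrarily small parameters;
    these are chosen recursively. *)
Lemma compact_cvg_along_decreasing {R : realType} (H : metricType R)
    (g : R -> H) (h0 : R) :
  compact [set: H] -> 0 < h0 ->
  exists (a : H) (hs : nat -> R),
    [/\ forall j, 0 < hs j < h0, decreasing_seq hs,
        hs j @[j --> \oo] --> (0 : R) & g (hs j) @[j --> \oo] --> a].
Proof.
move=> H_compact h0_gt0.
have [a [_ a_clu]] := H_compact (g h @[h --> 0^'+]) _ filterT.
(* Positivity of the bound is a premise under the existential, so that [next] is total; the value 0
   serves for the other bounds. *)
have /choice[next nextP] (nr : nat * R) :
    exists h, 0 < nr.2 -> 0 < h < nr.2 /\ ball a (harmonic nr.1) (g h).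
  case: nr => n r /=; have [r_gt0|r_le0] := ltP 0 r; last first.
    by exists 0.
  have [|_ [[h hr <-] ga]] := a_clu [set g h | h in [set h | 0 < h < r]] _ _
      (nbhsx_ballx a _ (@harmonic_gt0 R n)).
    have h_gt0 : \forall h \near 0^'+, (0 : R) < h := nbhs_right_gt 0.
    apply: filterS2 h_gt0 (nbhs_right_lt r_gt0) => h ? ?; exists h => //=.
    exact/andP.
  by exists h.
(* The bound [harmonic n] forces convergence to 0, the previous term strict decrease; [h0] stands in
   for the term before the first. *)
pose fix hs n := next (n, Num.min (harmonic n) (if n is k.+1 then hs k else h0)).
have hs_gt0 n : 0 < hs n.
  elim: n => [|n IHn]; rewrite /=.
    by have [] := nextP (0%N, Num.min (harmonic 0) h0); rewrite /= ?lt_min ?harmonic_gt0// => /andP[].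
  by have [] := nextP (n.+1, Num.min (harmonic n.+1) (hs n)); rewrite /= ?lt_min ?harmonic_gt0// => /andP[].
have hsP n : (hs n < harmonic n) && (hs n < if n is k.+1 then hs k else h0) /\
    ball a (harmonic n) (g (hs n)).
  have [|] := nextP (n, Num.min (harmonic n) (if n is k.+1 then hs k else h0)).
    by rewrite /= lt_min harmonic_gt0; case: n.
  by rewrite /= lt_min => /andP[_ hn] ga; case: n hn ga.
have hs_dec n : hs n.+1 < hs n by have [/andP[]] := hsP n.+1.
exists a, hs; split.
- move=> j; rewrite hs_gt0 /=; elim: j => [|j]; first by have [/andP[]] := hsP 0%N.
  exact: lt_trans.
- exact/decreasing_seqP.
- apply: (@squeeze_cvgr _ _ _ _ (cst 0) harmonic).
  + by apply: nearW => n; have [/andP[? _] _] := hsP n; rewrite /cst !ltW.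
  + exact: cvg_cst.
  + exact: cvg_harmonic.
- apply/cvg_ballP => e e_gt0.
  have : \forall n \near \oo, harmonic n < e :> R.
    by apply: cvgr_lt e_gt0; exact: cvg_harmonic.
  apply: filterS => n ne.
  by have [_] := hsP n; apply: le_ball; exact: ltW.
Qed.

(** * Convergence of the discrete minimizers *)

Theorem theorem2p11 (R : realType)
  (* the design space *)
  (H : metricType R)
  (H_nonempty : [set: H] !=set0) (H_compact : compact [set: H])
  (* the scale of Hilbert spaces *)
  (X : R -> completeNormedModType R)
  (ip : forall d : R, {dot X d for idfun})
  (X_hilbert : forall d, 0 <= d <= 1 -> induces_norm (ip d))
  (incl : forall d1 d2 : R, {linear X d1 -> X d2})
  (X_incl : coherent_inclusions incl)
  (X_cont : uniformly_continuous_inclusions incl)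
  (X01 : compactly_embedded_dense incl)
  (* the data of the problem *)
  (f : X 1)
  (B : forall d : R, H -> {symmetric X d})
  (B_bounded : forall d a, 0 <= d < 1 -> bounded_form (B d a))
  (phi : H -> R)
  (phi_ge0 : forall a, 0 <= phi a)
  (cvx : option (isConvexSpace.axioms_ R H))
  (phi_convex : convex_for cvx phi)
  (phi_lsc : lower_semicontinuous (fun a : H => (phi a)%:E))
  (S1 : assumption_S1 incl) (S2 : assumption_S2 incl)
  (B1 : assumption_B1 B) (B2 : assumption_B2 B) (B3 : assumption_B3 B)
  (B4 : assumption_B4 incl B) (B5 : assumption_B5 incl B)
  (B6 : assumption_B6 incl B)
  (* the discretization *)
  (h0 : R) (h0_gt0 : 0 < h0)
  (Xh : forall d : R, R -> set (X d))
  (Xh_subspace : forall d h, 0 <= d < 1 -> 0 < h < h0 ->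
     finite_dim_subspace (Xh d h))
  (Hh : R -> set H)
  (Hh_closed : forall h, 0 < h < h0 -> closed (Hh h))
  (D1 : assumption_D1 incl h0 Xh) (D2 : assumption_D2 h0 Xh)
  (Pi : R -> H -> H)
  (D3 : assumption_D3 phi h0 Hh Pi)
  (D4 : assumption_D4 incl B ip f Xh Pi)
  (* discrete minimizers *)
  (d : R) (d_range : 0 <= d < 1)
  (ah : R -> H) (uh : R -> X d)
  (ah_uh_min : forall h, 0 < h < h0 ->
     minimizes_objective incl ip f phi
       (discrete_admissible incl B ip f Xh Hh h) (ah h, uh h)) :
  exists (a : H) (u : X d),
    admissible incl B ip f (a, u) /\
    exists hs : nat -> R,
      [/\ forall j, 0 < hs j < h0,
          decreasing_seq hs
        & hs j @[j --> \oo] --> (0 : R)] /\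
      [/\ ah (hs j) @[j --> \oo] --> a,
          minimizes_objective incl ip f phi (admissible incl B ip f (d := d))
            (a, u),
          objective ip f phi (ah (hs j)) (incl d 1 (uh (hs j)))
            @[j --> \oo] --> objective ip f phi a (incl d 1 u),
          uh (hs j) @[j --> \oo] --> u
        & phi (ah (hs j)) @[j --> \oo] --> phi a].
Proof.
have [M M_gt0 S1d] := S1; have [A A_gt0 B2d] := B2.
have [alpha alpha_gt0 B3d] := B3.
pose l w := ip 1 f (incl d 1 w).
pose ip1 : {symmetric X 1} := ip 1.
have ip1_norm v : ip1 v v = `|v| ^+ 2 by apply: X_hilbert; rewrite ler01 lexx.
have l_lin : scalar l by move=> t x y; rewrite /l linearP (form_linear ip1).
have l_le v : `|l v| <= (`|f| * M) * `|v|.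
  have ip1_le : forall x y, `|ip1 x y| <= 1 * `|x| * `|y|.
    by apply: form_bound => // w; rewrite ip1_norm ?mul1r.
  rewrite (le_trans (ip1_le _ _))// mul1r -mulrA ler_wpM2l//.
  exact: S1d.
have B_ge0 a v : 0 <= B d a v v.
  by rewrite (le_trans _ (B3d d a v d_range))// mulr_ge0// ltW.
have B_def a v : B d a v v = 0 -> v = 0.
  move=> Bv; have := B3d d a v d_range; rewrite Bv pmulr_rle0// => v_le0.
  by apply/eqP; rewrite -normr_eq0 -sqrf_eq0 eq_le v_le0 sqr_ge0.
have B_le a : forall v w, `|B d a v w| <= A * `|v| * `|w|.
  apply: form_bound => //; first exact: ltW.
  by move=> v; rewrite (le_trans _ (B2d d a v d_range))// ler_norm.
have admE a u : admissible incl B ip f (a, u) -> forall w, B d a u w = l w.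
  by move=> u_min w; apply: (@form_argmin_Euler _ _ _ _ setT).
have [a [hs [hs_in hs_dec hs_0 ah_a]]] :=
  compact_cvg_along_decreasing ah H_compact h0_gt0.
have hs_right : hs j @[j --> \oo] --> 0^'+.
  move=> U /hs_0; rewrite /= /nbhs /=; apply: filterS => j /=; apply.
  by have /andP[] := hs_in j.
(* The limit state is obtained by solving the problem at the limit design, not as a limit of
   discrete states. *)
have [u u_min] : exists u : X d, admissible incl B ip f (a, u).
  by apply: (coercive_argmin alpha_gt0 _ (B_le a) l_lin l_le) => v; exact: B3d.
have Bu := admE _ _ u_min.
have Xh_lin j := finite_dim_subspace_lin (Xh_subspace d (hs j) d_range (hs_in j)).
pose x j := ah (hs j); pose y j : X d := uh (hs j).
have Xy j : Xh d (hs j) (y j) by have [[_ []]] := ah_uh_min _ (hs_in j).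
have By j w : Xh d (hs j) w -> B d (x j) (y j) w = l w.
  move=> Xw; have [[_ y_min] _] := ah_uh_min _ (hs_in j).
  by apply: form_argmin_Euler y_min w Xw => //; exact: Xh_lin.
have [wh Xwh wh_cvg] := D2 d u d_range.
pose w j := wh (hs j).
have Xw j : Xh d (hs j) (w j) by exact: Xwh.
have w_u : w j @[j --> \oo] --> u.
  apply: cvg_of_dist0; exact: (cvg_comp _ _ hs_right wh_cvg).
have Bw : B d (x j) (w j) (w j) @[j --> \oo] --> l u.
  rewrite -Bu; apply: (@form_cvg _ _ _ _ _ _ A) w_u _ => //.
  exact: B1.
have lw : l (w j) @[j --> \oo] --> l u by exact: scalar_cvg l_le w_u.
(* [w |-> 2 l(w) - B(w, w)] is maximal at the discrete state, with value the
   compliance [l (y j)]; [low j] evaluates it at an interpolant of [u]. *)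
pose low j := 2 * l (w j) - B d (x j) (w j) (w j).
have low_cvg : low j @[j --> \oo] --> l u.
  have -> : l u = 2 * l u - l u by ring.
  by apply: cvgB => //; apply: cvgM => //; exact: cvg_cst.
(* The discrete equation is tested with both [y j] and [w j]. Positivity of this gap bounds the
   compliance below; coercivity later turns it into strong convergence. *)
have gapE j : B d (x j) (y j - w j) (y j - w j) = l (y j) - low j.
  by rewrite form_B !By// /low; ring.
have low_le j : low j <= l (y j) by rewrite -subr_ge0 -gapE.
have phi_low e : 0 < e -> \forall j \near \oo, phi a - e < phi (x j).
  move=> e_gt0; have [|U aU phiU] := phi_lsc a (phi a - e).
    by rewrite lte_fin; lra.
  have Ux : \forall j \near \oo, U (x j) by exact: ah_a.
  by apply: filterS Ux => j /phiU; rewrite lte_fin.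
pose J j := l (y j) + phi (x j).
(* Recovery sequence: the discrete competitor built from [(b, v)] bounds [J j] from above. *)
have upper b v : admissible incl B ip f (b, v) -> exists2 up : nat -> R,
    forall j, J j <= up j & up j @[j --> \oo] --> l v + phi b.
  move=> v_min; pose g j := Ghat B Xh Pi (hs j) b v.
  exists (fun j => l (g j) + phi (Pi (hs j) b)).
    move=> j; have [_ J_min] := ah_uh_min _ (hs_in j).
    have [Pi_in _] := D3.
    apply: (J_min (Pi (hs j) b, g j)); split=> /=; first exact: Pi_in.
    (* Solvability shows that the set defining [Ghat] is inhabited, so its value is a solution and
       not the default 0. *)
    have [g0 g0_in g0_eq] := form_solve_span (B_ge0 (Pi (hs j) b)) (B_def _)
      (Xh_subspace d (hs j) d_range (hs_in j)) (form_linear (B d b) v).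
    have [g_in g_eq] := xgetPex (0 : X d) (ex_intro (fun g => Xh d (hs j) g /\
      forall wh, Xh d (hs j) wh -> B d (Pi (hs j) b) g wh = B d b v wh)
      g0 (conj g0_in g0_eq)).
    apply: form_Euler_argmin => // z Xz.
    by rewrite g_eq// (admE _ _ v_min).
  have [_ phi_Pi] := D3.
  apply: cvgD; last exact: (cvg_comp _ _ hs_right (phi_Pi b)).
  apply: (scalar_cvg l_lin l_le); apply: cvg_of_dist0.
  exact: (cvg_comp _ _ hs_right (D4 d b v d_range v_min)).
(* The upper bound is the recovery sequence of the limit pair [(a, u)] itself. *)
have J_cvg : J j @[j --> \oo] --> l u + phi a.
  have [up J_up up_cvg] := upper a u u_min.
  apply: (@squeeze_cvgr_eps _ _ _ _ (fun j => low j + phi a) _ _ _ _ J_up _ up_cvg).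
    move=> e e_gt0.
    apply: filterS (phi_low e e_gt0) => j phi_j.
    by rewrite -addrA lerD// ltW.
  by apply: cvgD low_cvg _; exact: cvg_cst.
have phi_cvg : phi (x j) @[j --> \oo] --> phi a.
  (* Since [low j <= l (y j)], the difference [J j - low j] dominates [phi (x j)], and it tends to
     [phi a]. *)
  apply: (@squeeze_cvgr_eps _ _ _ _ (cst (phi a)) _ (fun j => J j - low j)).
  - by move=> e /phi_low; apply: filterS => j /ltW.
  - by move=> j; have := low_le j; rewrite /J; lra.
  - exact: cvg_cst.
  - by rewrite -[phi a](addrK (l u)) [phi a + _]addrC; exact: cvgB.
have ly_cvg : l (y j) @[j --> \oo] --> l u.
  have -> : (fun j => l (y j)) = (fun j => J j - phi (x j)).
    by apply/funext => j; rewrite /J addrK.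
  by rewrite -[l u](addrK (phi a)); exact: cvgB.
exists a, u; split => //; exists hs; split => //; split => //.
- split=> // -[b v] v_min; have [up J_up up_cvg] := upper b v v_min.
  by apply: (ler_cvg_to J_cvg up_cvg); exact: nearW.
(* By coercivity [alpha] times the squared distance is at most the gap [l (y j) - low j], whose two
   terms have the same limit. *)
- have wy0 : `|y j - w j| @[j --> \oo] --> (0 : R).
    have gap0 : Num.sqrt (alpha^-1 * (l (y j) - low j)) @[j --> \oo] --> (0 : R).
      rewrite -sqrtr0; apply: continuous_cvg; first exact: sqrt_continuous.
      rewrite -(mulr0 alpha^-1) -(subrr (l u)).
      by apply: cvgM; [exact: cvg_cst|exact: cvgB].
    apply: (squeeze_cvgr _ (cvg_cst 0) gap0).
    apply: nearW => j; rewrite normr_ge0 /=.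
    have -> : `|y j - w j| = Num.sqrt (`|y j - w j| ^+ 2).
      by rewrite sqrtr_sqr normr_id.
    rewrite ler_wsqrtr// -gapE -(ler_pM2l alpha_gt0) mulVKf ?gt_eqF//.
    exact: B3d.
  have -> : (fun j => uh (hs j)) = (fun j => (y j - w j) + w j).
    by apply/funext => j; rewrite subrK.
  by rewrite -[u]add0r; apply: cvgD => //; exact: norm_cvg0.
Qed.
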